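(* Let $F$ be a field and let $B=\mathrm{Mat}_n(\Delta)$ be a central simple algebra over $F$, where $\Delta$ is the division part of $B$. Let $A=\prod_{i=1}^s A_i$ be a semi-simple $F$-algebra with simple factors $A_i$, and let $K_i$ be the center of $A_i$ for each $i$. Then there is an embedding of the $F$-algebra $A$ into $B$ if and only if there are positive integers $n_i$, for $i=1,\dots,s$, such that $$n=\sum_{i=1}^s n_i\quad\text{and}\quad [A_i:F]\ \mid\ n_ic_i\quad\text{for all } i=1,\dots,s,$$ where $c_i$ is the capacity of the central simple algebra $\Delta\otimes_F A_i^{\mathrm{o}}$ over $K_i$.
   Context: All $F$-algebras are finite-dimensional over the (arbitrary) field $F$; $F$-algebra homomorphisms send the identity to the identity; an embedding is an injective $F$-algebra homomorphism. $A_i^{\mathrm{o}}$ is the opposite algebra of $A_i$, and $[A_i:F]=\dim_F A_i$. The capacity of a central simple algebra $C$ (over its center) is the integer $c$ such that $C\simeq \mathrm{Mat}_c(D)$ with $D$ a division algebra; $D$ is called the division part of $C$. *)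

(* Defs.v *)
From HB Require Import structures.
From mathcomp Require Import all_boot all_algebra all_field.
From mathcomp Require Import boolp classical_sets.

Set Implicit Arguments.
Unset Strict Implicit.
Unset Printing Implicit Defensive.

Import GRing.Theory.

Local Open Scope ring_scope.

(* Finite-dimensional unital nonzero F-algebras are [falgType F]; identity-
   preserving F-algebra homomorphisms are ['AHom(A, B)].                      *)

(* The library gives the opposite ring R^c; if R is an F-algebra, so is R^c,
   with the same vector space structure.                                      *)
Section Opposite.
Variables (F : fieldType) (A : falgType F).

HB.instance Definition _ := Vector.copy A^c A.

Fact converse_scaleAl (k : F) (x y : A^c) :
  k *: (x * y) = (k *: x : A^c) * y.
Proof. exact: (@scalerAr F A k y x). Qed.
HB.instance Definition _ := GRing.Lmodule_isLalgebra.Build F A^c converse_scaleAl.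

Fact converse_scaleAr (k : F) (x y : A^c) :
  k *: (x * y) = x * (k *: y : A^c).
Proof. exact: (@scalerAl F A k y x). Qed.
HB.instance Definition _ := GRing.Lalgebra_isAlgebra.Build F A^c converse_scaleAr.

End Opposite.

(* ['M[D]_n] is a left D-module in the library, so the F-algebra structure
   (entrywise scaling by F) lives on an alias.  [matalg D n] is Mat_(n+1)(D). *)
Section MatrixAlgebra.
Variables (F : fieldType) (D : falgType F) (n : nat).

Definition matalg : Type := 'M[D]_n.+1.
HB.instance Definition _ := GRing.NzRing.copy matalg 'M[D]_n.+1.

Definition matalg_scale (k : F) (M : matalg) : matalg := map_mx ( *:%R k) M.

Fact matalg_scaleA a b M :
  matalg_scale a (matalg_scale b M) = matalg_scale (a * b) M.
Proof. by apply/matrixP=> i j; rewrite !mxE scalerA. Qed.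
Fact matalg_scale1 : left_id 1 matalg_scale.
Proof. by move=> M; apply/matrixP=> i j; rewrite !mxE scale1r. Qed.
Fact matalg_scaleDr : right_distributive matalg_scale +%R.
Proof. by move=> a M N; apply/matrixP=> i j; rewrite !mxE scalerDr. Qed.
Fact matalg_scaleDl M : {morph matalg_scale^~ M : a b / a + b}.
Proof. by move=> a b; apply/matrixP=> i j; rewrite !mxE scalerDl. Qed.
HB.instance Definition _ := GRing.Zmodule_isLmodule.Build F matalg
  matalg_scaleA matalg_scale1 matalg_scaleDr matalg_scaleDl.

Lemma matalg_scaleE (k : F) (M : matalg) i j : (k *: M) i j = k *: M i j.
Proof. by rewrite mxE. Qed.

Fact matalg_scaleAl (k : F) (M N : matalg) : k *: (M * N) = k *: M * N.
Proof.
apply/matrixP=> i j; rewrite matalg_scaleE !mxE scaler_sumr.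
by apply: eq_bigr => l _; rewrite matalg_scaleE scalerAl.
Qed.
HB.instance Definition _ := GRing.Lmodule_isLalgebra.Build F matalg
  matalg_scaleAl.

Fact matalg_scaleAr (k : F) (M N : matalg) : k *: (M * N) = M * (k *: N).
Proof.
apply/matrixP=> i j; rewrite matalg_scaleE !mxE scaler_sumr.
by apply: eq_bigr => l _; rewrite matalg_scaleE scalerAr.
Qed.
HB.instance Definition _ := GRing.Lalgebra_isAlgebra.Build F matalg
  matalg_scaleAr.

Import VectorInternalTheory.

Fact matalg_vect_iso :
  Vector.axiom (dim {ffun 'I_n.+1 * 'I_n.+1 -> D}) matalg.
Proof.
pose g (M : matalg) : {ffun _ -> D} := [ffun p : 'I_n.+1 * 'I_n.+1 => M p.1 p.2].
pose h (f : {ffun 'I_n.+1 * 'I_n.+1 -> D}) : matalg := \matrix_(i, j) f (i, j).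
exists (fun M => v2r (g M)).
  move=> k M N; rewrite -linearP; congr v2r; apply/ffunP=> p.
  by rewrite !ffunE mxE matalg_scaleE.
exists (fun r => h (r2v r)) => [M | r].
  by rewrite v2rK; apply/matrixP=> i j; rewrite mxE ffunE.
rewrite -[RHS]r2vK; congr v2r; apply/ffunP=> p.
by rewrite ffunE mxE -surjective_pairing.
Qed.
HB.instance Definition _ := Lmodule_hasFinDim.Build F matalg matalg_vect_iso.
HB.instance Definition _ := Algebra_isFalgebra.Build F matalg.

End MatrixAlgebra.

(* The product of the s+1 algebras A_0, ..., A_s. *)
Section ProductAlgebra.
Variables (F : fieldType) (s : nat) (A : 'I_s.+1 -> falgType F).

Definition prodalg : Type := {dffun forall i, A i}.
HB.instance Definition _ := Choice.copy prodalg {dffun forall i, A i}.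
Implicit Types x y z : prodalg.

Definition prodalg_of (f : forall i, A i) : prodalg := finfun f.
Definition prodalg_zero : prodalg := prodalg_of (fun i => 0).
Definition prodalg_opp x : prodalg := prodalg_of (fun i => - x i).
Definition prodalg_add x y : prodalg := prodalg_of (fun i => x i + y i).
Definition prodalg_one : prodalg := prodalg_of (fun i => 1).
Definition prodalg_mul x y : prodalg := prodalg_of (fun i => x i * y i).
Definition prodalg_scale (k : F) x : prodalg := prodalg_of (fun i => k *: x i).

Lemma prodalgP x y : (forall i, x i = y i) <-> x = y.
Proof. exact: ffunP. Qed.

Fact prodalg_addA : associative prodalg_add.
Proof. by move=> x y z; apply/prodalgP=> i; rewrite !ffunE addrA. Qed.
Fact prodalg_addC : commutative prodalg_add.
Proof. by move=> x y; apply/prodalgP=> i; rewrite !ffunE addrC. Qed.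
Fact prodalg_add0 : left_id prodalg_zero prodalg_add.
Proof. by move=> x; apply/prodalgP=> i; rewrite !ffunE add0r. Qed.
Fact prodalg_addN : left_inverse prodalg_zero prodalg_opp prodalg_add.
Proof. by move=> x; apply/prodalgP=> i; rewrite !ffunE addNr. Qed.
HB.instance Definition _ := GRing.isZmodule.Build prodalg
  prodalg_addA prodalg_addC prodalg_add0 prodalg_addN.

Fact prodalg_mulA : associative prodalg_mul.
Proof. by move=> x y z; apply/prodalgP=> i; rewrite !ffunE mulrA. Qed.
Fact prodalg_mul1l : left_id prodalg_one prodalg_mul.
Proof. by move=> x; apply/prodalgP=> i; rewrite !ffunE mul1r. Qed.
Fact prodalg_mul1r : right_id prodalg_one prodalg_mul.
Proof. by move=> x; apply/prodalgP=> i; rewrite !ffunE mulr1. Qed.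
Fact prodalg_mulDl : left_distributive prodalg_mul +%R.
Proof. by move=> x y z; apply/prodalgP=> i; rewrite !ffunE mulrDl. Qed.
Fact prodalg_mulDr : right_distributive prodalg_mul +%R.
Proof. by move=> x y z; apply/prodalgP=> i; rewrite !ffunE mulrDr. Qed.
Fact prodalg_one_neq0 : prodalg_one != 0.
Proof. by apply/eqP=> /prodalgP/(_ ord0)/eqP; rewrite !ffunE oner_eq0. Qed.
HB.instance Definition _ := GRing.Zmodule_isNzRing.Build prodalg
  prodalg_mulA prodalg_mul1l prodalg_mul1r prodalg_mulDl prodalg_mulDr
  prodalg_one_neq0.

Fact prodalg_scaleA a b x :
  prodalg_scale a (prodalg_scale b x) = prodalg_scale (a * b) x.
Proof. by apply/prodalgP=> i; rewrite !ffunE scalerA. Qed.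
Fact prodalg_scale1 : left_id 1 prodalg_scale.
Proof. by move=> x; apply/prodalgP=> i; rewrite !ffunE scale1r. Qed.
Fact prodalg_scaleDr : right_distributive prodalg_scale +%R.
Proof. by move=> a x y; apply/prodalgP=> i; rewrite !ffunE scalerDr. Qed.
Fact prodalg_scaleDl x : {morph prodalg_scale^~ x : a b / a + b}.
Proof. by move=> a b; apply/prodalgP=> i; rewrite !ffunE scalerDl. Qed.
HB.instance Definition _ := GRing.Zmodule_isLmodule.Build F prodalg
  prodalg_scaleA prodalg_scale1 prodalg_scaleDr prodalg_scaleDl.

Fact prodalg_scaleAl (k : F) x y : k *: (x * y) = k *: x * y.
Proof. by apply/prodalgP=> i; rewrite !ffunE scalerAl. Qed.
HB.instance Definition _ := GRing.Lmodule_isLalgebra.Build F prodalg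
  prodalg_scaleAl.
Fact prodalg_scaleAr (k : F) x y : k *: (x * y) = x * (k *: y).
Proof. by apply/prodalgP=> i; rewrite !ffunE scalerAr. Qed.
HB.instance Definition _ := GRing.Lalgebra_isAlgebra.Build F prodalg
  prodalg_scaleAr.

Import VectorInternalTheory.

Fact prodalg_vect_iso : Vector.axiom (\sum_i dim (A i)) prodalg.
Proof.
exists (fun x : prodalg => \mxrow_i v2r (x i)).
  by move=> k x y; apply/matrixP=> i j; rewrite !mxE !ffunE linearP !mxE.
exists (fun r => prodalg_of (fun i => r2v (submxrow r i))) => [x | r].
  by apply/prodalgP=> i; rewrite ffunE mxrowK v2rK.
by apply/mxrowP=> i; rewrite mxrowK ffunE r2vK.
Qed.
HB.instance Definition _ := Lmodule_hasFinDim.Build F prodalg prodalg_vect_iso.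
HB.instance Definition _ := Algebra_isFalgebra.Build F prodalg.

Lemma prodalg_addE x y i : (x + y) i = x i + y i.
Proof. by rewrite ffunE. Qed.
Lemma prodalg_mulE x y i : (x * y) i = x i * y i.
Proof. by rewrite ffunE. Qed.
Lemma prodalg_scaleE (k : F) x i : (k *: x) i = k *: x i.
Proof. by rewrite ffunE. Qed.
Lemma prodalg_1E i : (1 : prodalg) i = 1.
Proof. by rewrite ffunE. Qed.

End ProductAlgebra.

(* A tensor is the matrix of its coordinates on the products of the elements
   of the library's bases of A and B.                                         *)
Section TensorAlgebra.
Variables (F : fieldType) (A B : falgType F).
Local Notation m := (\dim {:A}).
Local Notation n := (\dim {:B}).
Local Notation e i := ((vbasis {:A})`_i).
Local Notation f j := ((vbasis {:B})`_j).

Definition tensor : Type := 'M[F]_(m, n).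
HB.instance Definition _ := Vector.copy tensor 'M[F]_(m, n).

Definition tens (a : A) (b : B) : tensor :=
  \matrix_(i, j) (coord (vbasis {:A}) i a * coord (vbasis {:B}) j b).

Lemma tens_linearl b : linear (tens^~ b).
Proof.
by move=> k a a'; apply/matrixP=> i j; rewrite !mxE linearP/= mulrDl mulrA.
Qed.

Lemma tens_linearr a : linear (tens a).
Proof.
move=> k b b'; apply/matrixP=> i j; rewrite !mxE linearP/= mulrDr.
by rewrite mulrCA.
Qed.

Let tensl b : {linear A -> tensor} := HB.pack (tens^~ b)
  (GRing.isLinear.Build F A tensor _ (tens^~ b) (tens_linearl b)).
Let tensr a : {linear B -> tensor} := HB.pack (tens a)
  (GRing.isLinear.Build F B tensor _ (tens a) (tens_linearr a)).

Lemma tens_suml I (r : seq I) (P : pred I) (E : I -> A) b :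
  tens (\sum_(i <- r | P i) E i) b = \sum_(i <- r | P i) tens (E i) b.
Proof. exact: (linear_sum (tensl b)). Qed.
Lemma tens_sumr I (r : seq I) (P : pred I) a (E : I -> B) :
  tens a (\sum_(i <- r | P i) E i) = \sum_(i <- r | P i) tens a (E i).
Proof. exact: (linear_sum (tensr a)). Qed.
Lemma tensZl (k : F) a b : tens (k *: a) b = k *: tens a b.
Proof. exact: (linearZZ (tensl b)). Qed.
Lemma tensZr (k : F) a b : tens a (k *: b) = k *: tens a b.
Proof. exact: (linearZZ (tensr a)). Qed.

Lemma tens_basis (i : 'I_m) (j : 'I_n) : tens (e i) (f j) = delta_mx i j.
Proof.
apply/matrixP=> k l; rewrite !mxE !coord_free ?(basis_free (vbasisP _)) //.
by rewrite -natrM mulnb (eq_sym i) (eq_sym j).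
Qed.

Lemma tensor_sum (x : tensor) :
  x = \sum_i \sum_j x i j *: tens (e i) (f j).
Proof.
rewrite {1}(matrix_sum_delta x); apply: eq_bigr => i _; apply: eq_bigr => j _.
by rewrite tens_basis.
Qed.

Definition tensor_mul (x y : tensor) : tensor :=
  \sum_i \sum_j \sum_k \sum_l
    (x i j * y k l) *: tens (e i * e k) (f j * f l).
Definition tensor_one : tensor := tens 1 1.

Fact tensor_mul_linearl y : linear (tensor_mul^~ y).
Proof.
move=> c x x'; rewrite /tensor_mul scaler_sumr -big_split; apply: eq_bigr => i _.
rewrite scaler_sumr -big_split; apply: eq_bigr => j _.
rewrite scaler_sumr -big_split; apply: eq_bigr => k _.
rewrite scaler_sumr -big_split; apply: eq_bigr => l _.
by rewrite !mxE mulrDl scalerDl scalerA mulrA.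
Qed.
Fact tensor_mul_linearr x : linear (tensor_mul x).
Proof.
move=> c y y'; rewrite /tensor_mul scaler_sumr -big_split; apply: eq_bigr => i _.
rewrite scaler_sumr -big_split; apply: eq_bigr => j _.
rewrite scaler_sumr -big_split; apply: eq_bigr => k _.
rewrite scaler_sumr -big_split; apply: eq_bigr => l _.
by rewrite !mxE mulrDr scalerDl scalerA mulrCA.
Qed.
Let tmull y : {linear tensor -> tensor} := HB.pack (tensor_mul^~ y)
  (GRing.isLinear.Build F tensor tensor _ (tensor_mul^~ y)
    (tensor_mul_linearl y)).
Let tmulr x : {linear tensor -> tensor} := HB.pack (tensor_mul x)
  (GRing.isLinear.Build F tensor tensor _ (tensor_mul x)
    (tensor_mul_linearr x)).

Fact tensor_mul_tens a b a' b' :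
  tensor_mul (tens a b) (tens a' b') = tens (a * a') (b * b').
Proof.
rewrite {2}(coord_vbasis (memvf a)) {2}(coord_vbasis (memvf b)).
rewrite mulr_suml tens_suml; apply: eq_bigr => i _.
rewrite mulr_suml tens_sumr; apply: eq_bigr => j _.
rewrite -!scalerAl {2}(coord_vbasis (memvf a')) {2}(coord_vbasis (memvf b')).
rewrite tensZl tensZr mulr_sumr tens_suml !scaler_sumr; apply: eq_bigr => k _.
rewrite mulr_sumr tens_sumr !scaler_sumr; apply: eq_bigr => l _.
by rewrite -!scalerAr tensZl tensZr !mxE !scalerA mulrA.
Qed.

Lemma tensor_ind (P : tensor -> Prop) :
    (forall x y, P x -> P y -> P (x + y)) -> P 0 ->
  (forall a b, P (tens a b)) -> forall x, P x.
Proof.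
move=> PD P0 Pt x; rewrite (tensor_sum x).
elim/big_ind: _ => // i _; elim/big_ind: _ => // j _.
by rewrite -tensZl.
Qed.

Fact tensor_mulDl : left_distributive tensor_mul +%R.
Proof. by move=> x y z; exact: (linearD (tmull z)). Qed.
Fact tensor_mulDr : right_distributive tensor_mul +%R.
Proof. by move=> x y z; exact: (linearD (tmulr x)). Qed.
Fact tensor_mul0l : left_zero 0 tensor_mul.
Proof. by move=> z; exact: (linear0 (tmull z)). Qed.
Fact tensor_mul0r : right_zero 0 tensor_mul.
Proof. by move=> z; exact: (linear0 (tmulr z)). Qed.
Fact tensor_mulA : associative tensor_mul.
Proof.
move=> x y z; elim/tensor_ind: x => [x x' IH IH'||a b].
- by rewrite !tensor_mulDl IH IH'.
- by rewrite !tensor_mul0l.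
elim/tensor_ind: y => [y y' IH IH'||a' b'].
- by rewrite !(tensor_mulDl, tensor_mulDr) IH IH'.
- by rewrite !(tensor_mul0l, tensor_mul0r).
elim/tensor_ind: z => [z z' IH IH'||a'' b''].
- by rewrite !tensor_mulDr IH IH'.
- by rewrite !tensor_mul0r.
by rewrite !tensor_mul_tens !mulrA.
Qed.
Fact tensor_mul1l : left_id tensor_one tensor_mul.
Proof.
elim/tensor_ind=> [x y IHx IHy||a b]; first by rewrite tensor_mulDr IHx IHy.
  by rewrite tensor_mul0r.
by rewrite tensor_mul_tens !mul1r.
Qed.
Fact tensor_mul1r : right_id tensor_one tensor_mul.
Proof.
elim/tensor_ind=> [x y IHx IHy||a b]; first by rewrite tensor_mulDl IHx IHy.
  by rewrite tensor_mul0l.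
by rewrite tensor_mul_tens !mulr1.
Qed.
Fact tensor_one_neq0 : tensor_one != 0.
Proof.
have nz (C : falgType F) : exists i, coord (vbasis {:C}) i 1 != 0.
  apply/existsP; apply: contraT; rewrite negb_exists => /forallP z.
  have /eqP[] := oner_neq0 C; rewrite (coord_vbasis (memvf 1)).
  by apply: big1 => i _; have /negPn/eqP-> := z i; rewrite scale0r.
have [i i1] := nz A; have [j j1] := nz B.
apply/eqP=> /matrixP/(_ i j)/eqP.
by rewrite !mxE mulf_eq0 (negPf i1) (negPf j1).
Qed.
HB.instance Definition _ := GRing.Zmodule_isNzRing.Build tensor
  tensor_mulA tensor_mul1l tensor_mul1r tensor_mulDl tensor_mulDr
  tensor_one_neq0.

Fact tensor_scaleAl (k : F) (x y : tensor) :
  k *: (x * y) = (k *: x : tensor) * y.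
Proof. exact/esym/(linearZZ (tmull y)). Qed.
HB.instance Definition _ := GRing.Lmodule_isLalgebra.Build F tensor
  tensor_scaleAl.
Fact tensor_scaleAr (k : F) (x y : tensor) :
  k *: (x * y) = x * (k *: y : tensor).
Proof. exact/esym/(linearZZ (tmulr x)). Qed.
HB.instance Definition _ := GRing.Lalgebra_isAlgebra.Build F tensor
  tensor_scaleAr.
HB.instance Definition _ := Algebra_isFalgebra.Build F tensor.

Lemma tensM a b a' b' : tens a b * tens a' b' = tens (a * a') (b * b').
Proof. exact: tensor_mul_tens. Qed.
Lemma tens1 : tens 1 1 = 1.
Proof. by []. Qed.

End TensorAlgebra.

Section AlgebraNotions.
Variable F : fieldType.
Implicit Types A B C D : falgType F.

Definition two_sided_ideal A (I : {vspace A}) : bool :=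
  ({:A} * I <= I)%VS && (I * {:A} <= I)%VS.

(* A falgType is nonzero, so A itself need not be assumed nonzero here. *)
Definition simple_algebra A : Prop :=
  forall I : {vspace A}, two_sided_ideal I -> I = 0%VS \/ I = {:A}%VS.

Definition central_simple_algebra A : Prop :=
  'Z({:A})%VS = 1%VS /\ simple_algebra A.

Definition division_algebra D : Prop :=
  forall x : D, x != 0 -> x \is a GRing.unit.

Definition embeds A B : Prop := exists f : 'AHom(A, B), injective f.

Definition isomorphic A B : Prop := exists f : 'AHom(A, B), bijective f.

(* An F-algebra isomorphism C -> Mat_c(D) carries the center of C onto that of
   D, hence it is also an isomorphism of algebras over the center of C, and D
   is the division part of C as a central simple algebra over its center.     *)
Definition is_capacity C (c : nat) : Prop :=
  exists n D, [/\ c = n.+1, division_algebra D & isomorphic C (matalg D n)].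

(* By Wedderburn's theorem a simple algebra C has exactly one c such that
   [is_capacity C c]; the default value 0 is only taken by algebras that are
   not simple.                                                                *)
Definition capacity C : nat := xget 0%N [set c | is_capacity C c]%classic.

End AlgebraNotions.

(* Main.v *)
From HB Require Import structures.
Require Import Defs.
From mathcomp Require Import all_boot all_algebra all_field.
From mathcomp Require Import boolp classical_sets.

(* A unital homomorphism from A_i to Mat_m(Delta) is a structure of right
   T_i-module, T_i = Delta (x) A_i^o, on Delta^m.  As Delta is central and A_i
   simple, T_i is simple, so it is Mat_c(D) for a division algebra D
   (Wedderburn), and the dimensions of the T_i-modules are the multiples of
   c [D:F].  Since [Delta:F] [A_i:F] = c^2 [D:F], the integer c [D:F] divides
   m [Delta:F] iff [A_i:F] divides m c.  An embedding of the product cuts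
   Delta^n, through the images of the central idempotents, into nonzero
   T_i-modules of Delta-dimensions n_i; conversely the T_i-modules Delta^(n_i)
   add up to a faithful module over the product.                             *)

Set Implicit Arguments.
Unset Strict Implicit.
Unset Printing Implicit Defensive.

Import GRing.Theory.

Local Open Scope ring_scope.

(** * Linear maps, and ranks of orthogonal idempotents *)

Section LinearMaps.
Variable F : fieldType.

Lemma linear_hom (U V : vectType F) (f : U -> V) :
  linear f -> exists g : 'Hom(U, V), forall u, g u = f u.
Proof.
move=> fP; pose g : {linear U -> V} := HB.pack f
  (GRing.isLinear.Build F U V _ f fP).
by exists (linfun g) => u; rewrite lfunE.
Qed.

(** Turns a formula bilinear in scalar and vector into an action; most module structures below arise
    this way. *)
Lemma bilinear_hom (U V W : vectType F) (f : U -> V -> W) :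
    (forall u, linear (f u)) -> (forall v, linear (f^~ v)) ->
  exists r : {linear U -> 'Hom(V, W)}, forall u v, r u v = f u v.
Proof.
move=> fr fl.
pose g u : {linear V -> W} := HB.pack (f u)
  (GRing.isLinear.Build F V W _ (f u) (fr u)).
have gP : linear (fun u => linfun (g u)).
  move=> k u u'; apply/lfunP=> v; rewrite add_lfunE scale_lfunE !lfunE; exact: fl.
pose r : {linear U -> 'Hom(V, W)} := HB.pack (fun u => linfun (g u))
  (GRing.isLinear.Build F U 'Hom(V, W) _ (fun u => linfun (g u)) gP).
by exists r => u v; rewrite lfunE.
Qed.

Lemma linear_ahom (A B : falgType F) (f : A -> B) :
    linear f -> (forall x y, f (x * y) = f x * f y) -> f 1 = 1 ->
  exists g : 'AHom(A, B), forall x, g x = f x.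
Proof.
move=> /linear_hom[g gE] fM f1.
have gP : ahom_in {:A} g by apply/ahom_inP; split=> [x y _ _|]; rewrite !gE.
by exists (AHom gP).
Qed.

Lemma dim_inj (U V : vectType F) (f : 'Hom(U, V)) :
  injective f -> \dim (limg f) = \dim {:U}.
Proof. by move=> /lker0P/eqP kf; rewrite limg_dim_eq // kf capv0. Qed.

Lemma dimv_ffun (I : finType) (V : vectType F) :
  \dim {:{ffun I -> V}} = (#|I| * \dim {:V})%N.
Proof. by rewrite !dimvf. Qed.

Lemma dim_bij (U V : vectType F) (f : 'Hom(U, V)) :
  bijective f -> \dim {:U} = \dim {:V}.
Proof.
move=> [g fK gK]; rewrite -(dim_inj (can_inj fK)); congr (\dim _).
by apply/vspaceP=> v; rewrite memvf -[v]gK memv_img ?memvf.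
Qed.

(** [p i] recovers the [i]-th summand of any sum of elements of the images, so the images are in
    direct sum; such a sum is fixed by [\sum_i p i], hence lies in its image. *)
Lemma dim_limg_orthogonal (I : finType) (V : vectType F) (p : I -> 'End(V)) :
    (forall i v, p i (p i v) = p i v) ->
    (forall i j v, i != j -> p i (p j v) = 0) ->
  \dim (limg (\sum_i p i)) = (\sum_i \dim (limg (p i)))%N.
Proof.
move=> pp p0.
have pS i (u : I -> V) : (forall j, u j \in limg (p j)) -> p i (\sum_j u j) = u i.
  move=> uP; rewrite linear_sum (bigD1 i) //= big1 ?addr0.
    by have /memv_imgP[v _ ->] := uP i; apply: pp.
  by move=> j ji; have /memv_imgP[v _ ->] := uP j; rewrite p0 1?eq_sym.
have ->: limg (\sum_i p i) = (\sum_i limg (p i))%VS.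
  apply/eqP; rewrite eqEsubv; apply/andP; split; apply/subvP=> v.
    move=> /memv_imgP[u _ ->]; rewrite sum_lfunE.
    by apply: memv_sumr => i _; apply: memv_img (memvf _).
  move=> /memv_sumP[u uP ->].
  have ->: \sum_i u i = (\sum_i p i) (\sum_i u i).
    by rewrite sum_lfunE; apply: eq_bigr => i _; rewrite pS // => j; apply: uP.
  exact: memv_img (memvf _).
have: directv (\sum_i limg (p i)); last by move/directvP.
apply/directv_sum_independent => u uP u0 i _.
by rewrite -(pS i u) ?u0 ?linear0 // => j; apply: uP.
Qed.

End LinearMaps.

(** * Right modules over algebras, and their bases over division algebras *)

Section RightModules.
Variable F : fieldType.

(* A right action of [A] on [V] need not be unital: the module is then the image
   of [r 1], which spares the construction of submodules as vector spaces.      *)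
Definition right_action (A : falgType F) (V : vectType F)
    (r : {linear A -> 'End(V)}) : Prop :=
  forall a b v, r (a * b) v = r b (r a v).

Lemma right_action1 (A : falgType F) (V : vectType F)
    (r : {linear A -> 'End(V)}) a v :
  right_action r -> r 1 (r a v) = r a v.
Proof. by move=> rM; rewrite -rM mulr1. Qed.

Lemma limg_right_action (A : falgType F) (V : vectType F)
    (r : {linear A -> 'End(V)}) v :
  right_action r -> (v \in limg (r 1)) = (r 1 v == v).
Proof.
move=> rM; apply/memv_imgP/eqP => [[u _ ->] | <-]; first exact: right_action1.
by exists v; rewrite ?memvf.
Qed.

Definition right_comb (D : falgType F) (V : vectType F)
    (r : {linear D -> 'End(V)}) m (v : 'I_m -> V) (d : 'I_m -> D) : V :=
  \sum_i r (d i) (v i).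

(** The conditions on [r 1] confine the notion to the image of [r 1], the unital part of [V]. *)
Record right_basis (D : falgType F) (V : vectType F)
    (r : {linear D -> 'End(V)}) m (v : 'I_m -> V) : Prop := RightBasis {
  right_basis1 : forall i, r 1 (v i) = v i;
  right_basis_free : forall d, right_comb r v d = 0 -> forall i, d i = 0;
  right_basis_span : forall w, r 1 w = w -> exists d, w = right_comb r v d }.

Lemma right_comb_hom (D : falgType F) (V : vectType F)
    (r : {linear D -> 'End(V)}) m (v : 'I_m -> V) :
  exists g : 'Hom({ffun 'I_m -> D}, V), forall d, g d = right_comb r v d.
Proof.
apply: linear_hom => k x y; rewrite /right_comb scaler_sumr -big_split.
by apply: eq_bigr => i _; rewrite !ffunE linearP add_lfunE scale_lfunE.
Qed.

Lemma dim_falg_gt0 (A : falgType F) : (0 < \dim {:A})%N.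
Proof. by rewrite dimvf FalgType_proper. Qed.

Lemma right_free_inj (D : falgType F) (V : vectType F)
    (r : {linear D -> 'End(V)}) m (v : 'I_m -> V)
    (g : 'Hom({ffun 'I_m -> D}, V)) :
    (forall d, g d = right_comb r v d) ->
    (forall d, right_comb r v d = 0 -> forall i, d i = 0) ->
  injective g.
Proof.
move=> gE vf; apply/lker0P; rewrite -subv0; apply/subvP=> d.
rewrite memv_ker memv0 gE => /eqP/vf d0; apply/eqP/ffunP=> i.
by rewrite ffunE d0.
Qed.

Lemma dim_right_basis (D : falgType F) (V : vectType F)
    (r : {linear D -> 'End(V)}) m (v : 'I_m -> V) :
  right_action r -> right_basis r v -> \dim (limg (r 1)) = (m * \dim {:D})%N.
Proof.
move=> rM [v1 vf vs]; have [g gE] := right_comb_hom r v.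
have := dim_inj (right_free_inj gE vf); rewrite dimv_ffun card_ord => <-.
congr (\dim _); apply/vspaceP=> w; rewrite limg_right_action //.
apply/eqP/memv_imgP => [/vs[d ->] | [d _ ->]].
  exists (finfun d); rewrite ?memvf // gE; apply: eq_bigr => i _.
  by rewrite ffunE.
rewrite gE linear_sum; apply: eq_bigr => i _; exact: right_action1.
Qed.

Lemma right_basis_uniq (D : falgType F) (V : vectType F)
    (r : {linear D -> 'End(V)}) m (v : 'I_m -> V) (d d' : 'I_m -> D) :
  right_basis r v -> right_comb r v d = right_comb r v d' -> d =1 d'.
Proof.
move=> vB /eqP; rewrite -subr_eq0 => /eqP dd' i; apply/eqP.
rewrite -subr_eq0; apply/eqP.
apply: (right_basis_free vB (d := fun i => d i - d' i)).
rewrite -{}[RHS]dd' -sumrB; apply: eq_bigr => j _.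
by rewrite linearB /= add_lfunE opp_lfunE.
Qed.

Lemma right_basis_mx_inj (D : falgType F) (V : vectType F)
    (r : {linear D -> 'End(V)}) m (v : 'I_m -> V) (M N : 'M[D]_m) :
    right_basis r v ->
    (forall j, right_comb r v (M^~ j) = right_comb r v (N^~ j)) ->
  M = N.
Proof.
move=> vB MN; apply/matrixP=> i j.
exact: (right_basis_uniq vB (MN j) i).
Qed.

Lemma right_comb_delta (D : falgType F) (V : vectType F)
    (r : {linear D -> 'End(V)}) m (v : 'I_m -> V) j :
  r 1 (v j) = v j -> right_comb r v (fun i => (i == j)%:R) = v j.
Proof.
move=> v1; rewrite /right_comb (bigD1 j) //= big1 ?addr0 ?eqxx //.
by move=> k /negPf->; rewrite linear0 zero_lfunE.
Qed.

(** A free family of maximal length spans: a [w] outside its span with [r 1 w = w] could be added to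
    it, since a nonzero coefficient of [w] in a relation is invertible. *)
Lemma right_basis_exists (D : falgType F) (V : vectType F)
    (r : {linear D -> 'End(V)}) :
    division_algebra D -> right_action r ->
  exists m (v : 'I_m -> V), right_basis r v.
Proof.
move=> Ddiv rM.
pose P m := exists v : 'I_m -> V, (forall i, r 1 (v i) = v i) /\
  (forall d, right_comb r v d = 0 -> forall i, d i = 0).
have P0 : exists m, `[< P m >].
  by exists 0%N; apply/asboolP; exists (fun=> 0); split=> [i|d _ i]; case: i.
have Pmax m : `[< P m >] -> (m <= \dim {:V})%N.
  move=> /asboolP[v [_ vf]]; have [g gE] := right_comb_hom r v.
  apply: leq_trans (dimvS (subvf (limg g))).
  rewrite (dim_inj (right_free_inj gE vf)) dimv_ffun card_ord.
  by rewrite leq_pmulr ?dim_falg_gt0.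
case: (ex_maxnP P0 Pmax) => m /asboolP[v [v1 vf]] mmax.
exists m, v; split=> // w w1; apply: contrapT => wN.
suff /asboolP/mmax : P m.+1 by rewrite ltnn.
exists (fun i => oapp v w (unlift ord0 i)).
split=> [i | d]; first by case: (unliftP ord0 i) => [j|] _; rewrite /= ?v1 ?w1.
rewrite /right_comb big_ord_recl unlift_none /= => d0.
have d0S : r (d ord0) w = - right_comb r v (fun i => d (lift ord0 i)).
  apply/eqP; rewrite -addr_eq0 -[X in _ == X]d0; apply/eqP; congr (_ + _).
  by apply: eq_bigr => i _; rewrite liftK.
have dw : d ord0 = 0.
  apply: contrapT => /eqP/Ddiv du; apply: wN.
  exists (fun i => - (d (lift ord0 i) * (d ord0)^-1)).
  rewrite -w1 -(mulrV du) rM d0S linearN linear_sum /= -sumrN.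
  by apply: eq_bigr => i _; rewrite linearN opp_lfunE rM.
move: d0S; rewrite dw linear0 zero_lfunE => /esym/eqP; rewrite oppr_eq0.
by move=> /eqP/vf dS i; case: (unliftP ord0 i) => [j|] ->.
Qed.

Lemma dvd_dim_right_action (D : falgType F) (V : vectType F)
    (r : {linear D -> 'End(V)}) :
  division_algebra D -> right_action r -> (\dim {:D} %| \dim (limg (r 1%R)))%N.
Proof.
move=> Ddiv rM; have [m [v /(dim_right_basis rM)->]] := right_basis_exists Ddiv rM.
exact: dvdn_mull.
Qed.

(** Column [j] of [f a] holds the coordinates of [l a (v j)]. As scalars act on the right, operators
    commuting with them compose like their matrices, with no opposite algebra. *)
Lemma endomorphism_matrix (A D : falgType F) (V : vectType F)
    (l : {linear A -> 'End(V)}) (r : {linear D -> 'End(V)}) m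
    (v : 'I_m.+1 -> V) :
    right_action r -> right_basis r v ->
    (forall a b w, l (a * b) w = l a (l b w)) -> (forall w, l 1 w = w) ->
    (forall a d w, l a (r d w) = r d (l a w)) ->
  exists f : 'AHom(A, matalg D m),
    forall a j, l a (v j) = right_comb r v (fun i => (f a : 'M_m.+1) i j).
Proof.
move=> rM vB lM l1 lr; have [v1 vf vs] := vB.
have [c cE] : exists c : A -> 'I_m.+1 -> 'I_m.+1 -> D, forall a j,
    l a (v j) = right_comb r v (c a j).
  suff /choice[c cE] : forall a, exists c : 'I_m.+1 -> 'I_m.+1 -> D,
    forall j, l a (v j) = right_comb r v (c j) by exists c.
  move=> a.
  suff /choice[c cE] : forall j, exists d, l a (v j) = right_comb r v d.
    by exists c.
  by move=> j; apply: vs; rewrite -lr v1.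
pose f a : matalg D m := \matrix_(i, j) c a j i.
have fE a j : l a (v j) = right_comb r v (fun i => (f a : 'M_m.+1) i j).
  by rewrite cE; apply: eq_bigr => i _; rewrite mxE.
have [||| g gE] := @linear_ahom F A (matalg D m) f; last first.
- by exists g => a j; rewrite gE.
- apply: (right_basis_mx_inj vB) => j; rewrite -fE l1.
  rewrite -[LHS](right_comb_delta (v1 j)).
  by apply: eq_bigr => i _; rewrite mxE.
- move=> a b; apply: (right_basis_mx_inj vB) => j.
  rewrite -fE lM fE linear_sum /right_comb /=.
  under eq_bigr => k _ do rewrite lr fE linear_sum.
  rewrite exchange_big; apply: eq_bigr => k _ /=; rewrite mxE linear_sum sum_lfunE.
  by apply: eq_bigr => h _; rewrite rM.
- move=> k a b; apply: (right_basis_mx_inj vB) => j.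
  rewrite -fE linearP add_lfunE scale_lfunE !fE /right_comb scaler_sumr -big_split.
  apply: eq_bigr => h _; rewrite /= -scale_lfunE -add_lfunE -linearP.
  by rewrite [in RHS]mxE matalg_scaleE.
Qed.

End RightModules.

(** * Matrix algebras and the dimensions of their modules *)

Section MatrixModules.
Variable F : fieldType.

Lemma dim_matalg (D : falgType F) n :
  \dim {:matalg D n} = (n.+1 * n.+1 * \dim {:D})%N.
Proof. by rewrite !dimvf -[X in (X * X * _)%N](card_ord n.+1) -card_prod. Qed.

Definition elem_mx (D : falgType F) n (i j : 'I_n.+1) (d : D) : matalg D n :=
  \matrix_(k, l) (d *+ ((k == i) && (l == j))).

Lemma elem_mx_linear (D : falgType F) n (i j : 'I_n.+1) :
  linear (@elem_mx D n i j).
Proof.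
move=> k a b; apply/matrixP=> x y; rewrite !mxE.
by case: (_ && _); rewrite ?mulr1n ?mulr0n ?scaler0 ?addr0.
Qed.

Lemma elem_mxM (D : falgType F) n (i j l : 'I_n.+1) (a b : D) :
  elem_mx i j a * elem_mx j l b = elem_mx i l (a * b).
Proof.
apply/matrixP=> x y; rewrite !mxE (bigD1 j) //= big1 ?addr0 => [|k kj].
  rewrite !mxE eqxx andbT /=.
  by case: (x == i); case: (y == l); rewrite ?mulr1n ?mulr0n ?mul0r ?mulr0.
by rewrite !mxE (negPf kj) andbF mulr0n mul0r.
Qed.

Lemma elem_mxM0 (D : falgType F) n (i j k l : 'I_n.+1) (a b : D) :
  j != k -> elem_mx i j a * elem_mx k l b = 0.
Proof.
move=> jk; apply/matrixP=> x y; rewrite !mxE big1 // => z _; rewrite !mxE.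
have [->|] := eqVneq z j; last by rewrite andbF mulr0n mul0r.
by rewrite (negPf jk) mulr0n mulr0.
Qed.

Lemma sum_elem_mx1 (D : falgType F) n :
  \sum_i elem_mx i i (1 : D) = 1 :> matalg D n.
Proof.
apply/matrixP=> x y; rewrite summxE mxE (bigD1 x) //= big1 ?addr0.
  by rewrite mxE eqxx eq_sym.
by move=> z zx; rewrite mxE eq_sym (negPf zx).
Qed.

(** The diagonal matrix units act as [n.+1] orthogonal idempotents with sum [r 1]. They have equal
    rank, and the image of one of them is a [D]-module. *)
Lemma dvd_dim_matalg_action (D : falgType F) n (V : vectType F)
    (r : {linear matalg D n -> 'End(V)}) :
    division_algebra D -> right_action r ->
  (n.+1 * \dim {:D} %| \dim (limg (r 1%R)))%N.
Proof.
move=> Ddiv rM; pose p i := r (elem_mx i i 1).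
have dim_limg_le (f : 'End(V)) U : (\dim (f @: U) <= \dim U)%N.
  by rewrite -[leqRHS](limg_ker_dim f) leq_addl.
have rank_le i j : (\dim (limg (p i)) <= \dim (limg (p j)))%N.
  (* This is [e_ii = e_ij e_jj e_ji], in the order reversed by the right action. *)
  have ->: p i = (r (elem_mx j i 1) \o p j \o r (elem_mx i j 1))%VF.
    by apply/lfunP=> v; rewrite !comp_lfunE /= -!rM !elem_mxM !mulr1.
  rewrite !limg_comp; apply: leq_trans (dim_limg_le _ _) _.
  exact/dimvS/limgS/subvf.
have ->: limg (r 1) = limg (\sum_i p i) by rewrite -sum_elem_mx1 linear_sum.
rewrite dim_limg_orthogonal.
- rewrite (eq_bigr (fun=> \dim (limg (p ord0)))); last first.
    by move=> i _; apply/eqP; rewrite eqn_leq !rank_le.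
  rewrite sum_nat_const card_ord dvdn_pmul2l //.
  (* The corner at [ord0] is a copy of [D] whose unit acts as [p ord0]. *)
  pose r0 : {linear D -> 'End(V)} := HB.pack (r \o elem_mx ord0 ord0)
    (GRing.isLinear.Build F D 'End(V) _ (r \o elem_mx ord0 ord0)
      (fun k a b => etrans (congr1 r (elem_mx_linear ord0 ord0 k a b))
        (linearP r k _ _))).
  apply: (@dvd_dim_right_action _ _ _ r0) => // a b v.
  by rewrite /= -(elem_mxM ord0 ord0 ord0) rM.
- by move=> i v; rewrite /p -rM elem_mxM mulr1.
- by move=> i j v ij; rewrite /p -rM elem_mxM0 1?eq_sym // linear0 zero_lfunE.
Qed.

Lemma ahom_inv (A B : falgType F) (f : 'AHom(A, B)) :
  bijective f -> exists g : 'AHom(B, A), cancel f g /\ cancel g f.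
Proof.
move=> [g fK gK]; have [||| h hE] := @linear_ahom F B A g.
- by move=> k x y; apply: (can_inj fK); rewrite linearP /= !gK.
- by move=> x y; apply: (can_inj fK); rewrite rmorphM /= !gK.
- by rewrite -(rmorph1 f) fK.
by exists h; split=> x; rewrite hE ?fK ?gK.
Qed.

Lemma right_action_comp (A B : falgType F) (V : vectType F) (f : 'AHom(A, B))
    (r : {linear B -> 'End(V)}) :
    right_action r ->
  exists2 r' : {linear A -> 'End(V)}, right_action r' & forall a, r' a = r (f a).
Proof.
move=> rM; pose r' : {linear A -> 'End(V)} := (r \o f)%FUN.
by exists r' => // a b v; rewrite /r' /= rmorphM rM.
Qed.

End MatrixModules.

(** * Simple algebras and injectivity *)

Section Simplicity.
Variable F : fieldType.

Lemma two_sided_idealP (A : falgType F) (I : {vspace A}) :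
  reflect (forall a x, x \in I -> a * x \in I /\ x * a \in I)
    (two_sided_ideal I).
Proof.
apply: (iffP andP) => [[/prodvP l /prodvP r] a x xI | lr].
  by rewrite l ?memvf // r ?memvf.
by split; apply/prodvP=> x a xI aI; [have [] := lr x a aI | have [] := lr a x xI].
Qed.

(** Both algebras have the same two-sided ideals, with left and right exchanged. *)
Lemma simple_converse (A : falgType F) :
  simple_algebra A -> simple_algebra A^c.
Proof.
move=> Asimple I /two_sided_idealP Iid; apply: (Asimple I).
by apply/two_sided_idealP => a x xI; have [] := Iid a x xI.
Qed.

Lemma simple_kernel (A : falgType F) (V : vectType F) (g : 'Hom(A, V)) :
    simple_algebra A -> g 1 != 0 ->
    (forall a x, g x = 0 -> g (a * x) = 0 /\ g (x * a) = 0) ->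
  injective g.
Proof.
move=> Asimple g1 gP; apply/lker0P/eqP.
have [|->|kT] // := Asimple (lker g); last first.
  by case/negP: g1; rewrite -memv_ker kT memvf.
apply/two_sided_idealP => a x; rewrite !memv_ker => /eqP/(gP a)[-> ->].
by rewrite eqxx.
Qed.

Lemma simple_ahom_inj (A B : falgType F) (f : 'AHom(A, B)) :
  simple_algebra A -> injective f.
Proof.
move=> Asimple; apply: simple_kernel => // [|a x fx].
  by rewrite rmorph1 oner_neq0.
by rewrite !rmorphM /= fx mul0r mulr0.
Qed.

Lemma ideal_top (A : falgType F) (I : {vspace A}) :
  two_sided_ideal I -> 1 \in I -> I = {:A}%VS.
Proof.
move=> /two_sided_idealP Iid I1; apply/vspaceP=> x; rewrite memvf.
by have [] := Iid x 1 I1; rewrite mulr1.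
Qed.

End Simplicity.

(** * Tensor products and their simplicity *)

Section Tensors.
Variable F : fieldType.

(** The universal property: the map is prescribed on the basis tensors, and bilinearity propagates
    the formula to all pure tensors. *)
Lemma tensor_lift (A B : falgType F) (W : vectType F) (b : A -> B -> W) :
    (forall x, linear (b x)) -> (forall y, linear (b^~ y)) ->
  exists g : 'Hom(tensor A B, W), forall x y, g (tens x y) = b x y.
Proof.
move=> br bl; have [r rE] := bilinear_hom br bl.
pose h (x : tensor A B) :=
  \sum_i \sum_j x i j *: b (vbasis {:A})`_i (vbasis {:B})`_j.
have [|g gE] := @linear_hom _ _ _ h.
  move=> k x y; rewrite /h scaler_sumr -big_split; apply: eq_bigr => i _.
  rewrite scaler_sumr -big_split; apply: eq_bigr => j _.
  by rewrite !mxE scalerDl scalerA.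
exists g => x y; rewrite gE /h -rE.
rewrite [in RHS](coord_vbasis (memvf x)) linear_sum sum_lfunE.
apply: eq_bigr => i _ /=; rewrite [in RHS](coord_vbasis (memvf y)) linear_sum.
apply: eq_bigr => j _; rewrite !linearZ /= scale_lfunE linearZ /= rE mxE.
by rewrite scalerA.
Qed.

Lemma dim_tensor (A B : falgType F) :
  \dim {:tensor A B} = (\dim {:A} * \dim {:B})%N.
Proof. by rewrite [LHS]dimvf. Qed.

(** Views the tensor product as a free [A]-module on the basis of [B]; supports in the proof of
    simplicity are taken in these coordinates. *)
Lemma tens_coord (A B : falgType F) :
  exists c : 'I_(\dim {:B}) -> 'Hom(tensor A B, A),
    (forall j x y, c j (tens x y) = coord (vbasis {:B}) j y *: x) /\
    (forall x, x = \sum_j tens (c j x) (vbasis {:B})`_j).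
Proof.
suff /choice[c cE] : forall j, exists c : 'Hom(tensor A B, A),
    forall x y, c (tens x y) = coord (vbasis {:B}) j y *: x.
  exists c; split=> //; elim/tensor_ind => [x y Ex Ey||x y].
  - rewrite {1}Ex {1}Ey -big_split; apply: eq_bigr => j _.
    by rewrite linearD /= -[c j x]scale1r tens_linearl !scale1r.
  - rewrite big1 // => j _; rewrite linear0; apply/matrixP=> i k.
    by rewrite !mxE linear0 mul0r.
  rewrite [in LHS](coord_vbasis (memvf y)) tens_sumr.
  by apply: eq_bigr => j _; rewrite cE tensZr tensZl.
move=> j; apply: tensor_lift => x k y z.
  by rewrite linearP /= scalerDl scalerA.
by rewrite scalerDr !scalerA mulrC.
Qed.

(* An element of minimal support of a nonzero ideal, scaled to have a coordinate
   1, commutes with D, so that its coordinates are in F: it is some 1 (x) b.   *)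
Lemma tensor_simple (D A : falgType F) :
    division_algebra D ->
    (forall x : D, (forall y, x * y = y * x) -> exists k : F, x = k%:A) ->
    simple_algebra A ->
  simple_algebra (tensor D A).
Proof.
move=> Ddiv Dcent Asimple I /[dup] Iid /two_sided_idealP IP.
have [|I0] := eqVneq I 0%VS; [by left | right].
apply: ideal_top => //; rewrite -tens1.
have [c [cE cS]] := tens_coord D A.
have cMl j d x : c j (tens d 1 * x) = d * c j x.
  elim/tensor_ind: x => [x y Ex Ey||x y].
  - by rewrite !mulrDr !linearD /= mulrDr Ex Ey.
  - by rewrite mulr0 linear0 mulr0.
  by rewrite tensM !cE mul1r scalerAr.
have cMr j d x : c j (x * tens d 1) = c j x * d.
  elim/tensor_ind: x => [x y Ex Ey||x y].
  - by rewrite !mulrDl !linearD /= mulrDl Ex Ey.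
  - by rewrite mul0r linear0 mul0r.
  by rewrite tensM !cE mulr1 scalerAl.
pose supp x := [set j | c j x != 0].
have [b b0 bI] : exists2 b : A, b != 0 & tens 1 b \in I.
  have [x xI x0] : exists2 x, x \in I & x != 0.
    by exists (vpick I); rewrite ?memv_pick ?vpick0.
  have [m] := ubnP #|supp x|; elim: m => // m IH in x xI x0 *.
  rewrite ltnS => le_m.
  have [j cj] : exists j, c j x != 0.
    apply/existsP; apply: contraNT x0; rewrite negb_exists => /forallP x0.
    rewrite (cS x) big1 // => j _; have /negPn/eqP-> := x0 j.
    by apply/matrixP=> i k; rewrite !mxE linear0 mul0r.
  pose y := tens (c j x)^-1 1 * x.
  have yI : y \in I by have [] := IP (tens (c j x)^-1 1) x xI.
  have cy : c j y = 1 by rewrite cMl mulVr // Ddiv.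
  have y0 : y != 0 by apply: contra_eq_neq cy => ->; rewrite linear0 eq_sym oner_neq0.
  case: (pselect (forall d, tens d 1 * y = y * tens d 1)) => [yC | ].
    have /choice[k kE] i : exists k : F, c i y = k%:A.
      by apply: Dcent => d; rewrite -cMr -cMl yC.
    have yE : y = tens 1 (\sum_i k i *: (vbasis {:A})`_i).
      rewrite (cS y) tens_sumr; apply: eq_bigr => i _.
      by rewrite kE tensZl tensZr.
    exists (\sum_i k i *: (vbasis {:A})`_i); last by rewrite -yE.
    apply: contraNneq y0 => b0; rewrite yE b0; apply/eqP/matrixP=> i l.
    by rewrite !mxE linear0 mulr0.
  (* The commutator of [y] with [tens d 1] stays in [I], has no new coordinate and loses the one at
     [j], which becomes [d - d]: the support shrinks. *)
  move/existsNP=> [d /eqP]; rewrite -subr_eq0 => z0.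
  apply: (IH (tens d 1 * y - y * tens d 1)) => //.
    by have [l r] := IP (tens d 1) y yI; rewrite rpredB.
  apply: leq_trans le_m; apply/proper_card/properP; split.
    apply/fintype.subsetP=> i; rewrite !inE; apply: contraNneq => ci.
    by rewrite linearB /= cMl cMr cMl ci !mulr0 mul0r subrr.
  by exists j; rewrite !inE // linearB /= cMl cMr cy mulr1 mul1r subrr eqxx.
(* The [b] with [tens 1 b] in [I] form a two-sided ideal of [A], nonzero by the above, hence
   containing 1. *)
have [g gE] : exists g : 'Hom(A, tensor D A), forall b, g b = tens 1 b.
  by apply: linear_hom => k x y; exact: tens_linearr.
suff JT : (g @^-1: I)%VS = {:A}%VS by rewrite -gE memv_preim JT memvf.
case: (Asimple (g @^-1: I)%VS) => // [|J0].
  apply/two_sided_idealP => a x; rewrite -!memv_preim !gE => xI.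
  by have [] := IP (tens 1 a) _ xI; rewrite !tensM !mulr1.
by case/negP: b0; rewrite -memv0 -J0 -memv_preim gE.
Qed.

End Tensors.

(** * Wedderburn's theorem by minimal left ideals *)

Section Wedderburn.
Variable F : fieldType.

Lemma prodv_ind (T : falgType F) (U V : {vspace T}) (P : T -> Prop) :
    P 0 -> (forall x y, P x -> P y -> P (x + y)) ->
    (forall u v, u \in U -> v \in V -> P (u * v)) ->
  forall x, x \in (U * V)%VS -> P x.
Proof.
move=> P0 PD PM x; rewrite unlock => /coord_span->.
elim/big_ind: _ => // i _; set w := _`_i.
have /allpairsP[[u v] [/= uU vV ->]] : w \in allpairs *%R (vbasis U) (vbasis V).
  by apply: mem_nth; rewrite size_tuple.
by rewrite scalerAl; apply: PM; rewrite ?memvZ // vbasis_mem.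
Qed.

Definition left_ideal (T : falgType F) (L : {vspace T}) : Prop :=
  forall a x, x \in L -> a * x \in L.

Lemma minimal_left_ideal (T : falgType F) :
  exists L : {vspace T}, [/\ left_ideal L, L <> 0%VS & forall M,
    left_ideal M -> (M <= L)%VS -> M <> 0%VS -> M = L].
Proof.
pose P m := exists2 L : {vspace T}, left_ideal L /\ L <> 0%VS & \dim L = m.
have P0 : exists m, `[< P m >].
  exists (\dim {:T}); apply/asboolP; exists {:T}%VS => //; split=> [a x _|].
    exact: memvf.
  by apply/eqP; rewrite -dimv_eq0 -lt0n dim_falg_gt0.
case: (ex_minnP P0) => _ /asboolP[L [Lid L0] <-] Lmin.
exists L; split=> // M Mid ML M0; apply/eqP; rewrite eqEdim ML.
by apply: Lmin; apply/asboolP; exists M.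
Qed.

(** [L T] is a two-sided ideal, nonzero because it contains [L = L 1]. *)
Lemma simple_left_idealM (T : falgType F) (L : {vspace T}) :
  simple_algebra T -> left_ideal L -> L <> 0%VS -> (L * {:T})%VS = {:T}%VS.
Proof.
move=> Tsimple Lid L0; have [||//] := Tsimple (L * {:T})%VS.
  apply/andP; split; last by rewrite -prodvA prodvS ?subvf.
  by rewrite prodvA prodvS //; apply/prodvP=> a x _ /Lid.
move=> LT0; case: L0; apply/eqP; rewrite -subv0 -LT0 -[X in (X <= _)%VS]prodv1.
by rewrite prodvS ?subvf.
Qed.

(* Brauer's lemma: [L x = L] for some [x] in [L], and the [e] in [L] with
   [e x = x] is idempotent as [x] has no left annihilator in [L].          *)
Lemma minimal_left_ideal_idempotent (T : falgType F) (L : {vspace T}) :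
    simple_algebra T -> left_ideal L -> L <> 0%VS ->
    (forall M, left_ideal M -> (M <= L)%VS -> M <> 0%VS -> M = L) ->
  exists e, [/\ e \in L, e != 0 & forall u, u \in L -> u * e = u].
Proof.
move=> Tsimple Lid L0 Lmin.
have [x [y [xL yL xy]]] : exists x y, [/\ x \in L, y \in L & y * x != 0].
  (* Otherwise [L L = 0], and [L] lies in [L T = L (L T) = (L L) T = 0]. *)
  apply: contrapT => LL0; apply: (L0); apply/eqP; rewrite -subv0.
  have LL : (L * L)%VS = 0%VS.
    apply/eqP; rewrite -subv0; apply/prodvP=> y x yL xL; rewrite memv0.
    by apply: contrapT => yx; apply: LL0; exists x, y; split=> //; apply/negP.
  rewrite -[X in (X <= _)%VS]prodv1 -(prod0v {:T}%VS) -LL -prodvA.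
  by rewrite (simple_left_idealM Tsimple Lid L0) prodvS ?subvf.
(* [L x] and the left annihilator of [x] in [L] are left ideals inside [L]; by minimality and
   [y * x != 0], the first is [L] and the second is zero. *)
have Lx : (amulr x @: L)%VS = L.
  apply: Lmin.
  - move=> a _ /memv_imgP[u uL ->]; rewrite lfunE /= mulrA.
    by apply/memv_imgP; exists (a * u); rewrite ?Lid // lfunE.
  - by apply/subvP=> _ /memv_imgP[u uL ->]; rewrite lfunE Lid.
  - move=> Lx0; case/negP: xy; rewrite -memv0 -Lx0.
    by apply/memv_imgP; exists y; rewrite ?lfunE.
have annx u : u \in L -> u * x = 0 -> u = 0.
  move=> uL ux; apply/eqP; rewrite -memv0.
  suff <-: (L :&: lker (amulr x))%VS = 0%VS by rewrite memv_cap uL memv_ker lfunE /= ux.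
  apply: contrapT => N0; case/negP: xy; have /subvP/(_ y yL): (L <= lker (amulr x))%VS.
    rewrite -{1}(Lmin (L :&: lker (amulr x))%VS) ?capvSl ?capvSr //.
    move=> a z; rewrite !memv_cap !memv_ker !lfunE /= => /andP[/Lid-> /eqP zx].
    by rewrite -mulrA zx mulr0 eqxx.
  by rewrite memv_ker lfunE.
have /memv_imgP[e eL] : x \in (amulr x @: L)%VS by rewrite Lx.
rewrite lfunE /= => ex; exists e; split=> // [|u uL].
  by apply: contraNneq xy => e0; rewrite ex e0 mul0r mulr0.
apply/eqP; rewrite -subr_eq0; apply/eqP/annx; first by rewrite rpredB ?Lid.
by rewrite mulrBl -mulrA -ex subrr.
Qed.


(** * The division algebra cut out by an idempotent *)

Section Corner.
Variables (T : falgType F) (e : T).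
Hypotheses (ee : e * e = e) (e0 : e != 0).

(** This is [e T e], written as an intersection of two kernels; as an algebra it has identity [e],
    not the 1 of [T]. *)
Definition corner_space : {vspace T} :=
  (lker (amulr e - \1%VF) :&: lker (amull e - \1%VF))%VS.

Lemma mem_corner u : (u \in corner_space) = (u * e == u) && (e * u == u).
Proof.
by rewrite memv_cap !memv_ker !add_lfunE !opp_lfunE !id_lfunE !lfunE /= !subr_eq0.
Qed.

Lemma corner_is_aspace : is_aspace corner_space.
Proof.
apply/andP; split.
  apply/has_algidP; exists e; split=> // [|u]; first by rewrite mem_corner ee eqxx.
  by rewrite mem_corner => /andP[/eqP-> /eqP->].
apply/prodvP=> u v; rewrite !mem_corner => /andP[_ /eqP eu] /andP[/eqP ve _].
by rewrite -mulrA ve mulrA eu !eqxx.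
Qed.

Definition corner : {aspace T} := ASpace corner_is_aspace.

Lemma corner_algid : algid corner = e.
Proof.
have eC : e \in corner by rewrite mem_corner ee eqxx.
have := memv_algid corner; rewrite mem_corner => /andP[/eqP <- _].
exact: algidl.
Qed.

Lemma mem_cornerM t : e * t * e \in corner.
Proof. by rewrite mem_corner -!mulrA ee !mulrA ee !eqxx. Qed.

(** For [u != 0] in the corner, [L u] contains [e u = u], so [L u = L] by minimality, and [e = v u]
    gives the left inverse [e v e]. This one has a left inverse too, which must be [u]. *)
Lemma corner_division (L : {vspace T}) :
    left_ideal L -> e \in L -> (forall u, u \in L -> u * e = u) ->
    (forall M, left_ideal M -> (M <= L)%VS -> M <> 0%VS -> M = L) ->
  division_algebra (subvs_of corner).
Proof.
move=> Lid eL Le Lmin.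
have linv u : u \in corner -> u != 0 -> exists2 w, w \in corner & w * u = e.
  rewrite mem_corner => /andP[/eqP ue /eqP eu] u0.
  have Lu : (amulr u @: L)%VS = L.
    apply: Lmin.
    - move=> a _ /memv_imgP[v vL ->]; rewrite lfunE /= mulrA.
      by apply/memv_imgP; exists (a * v); rewrite ?Lid // lfunE.
    - apply/subvP=> _ /memv_imgP[v vL ->]; rewrite lfunE /= -ue mulrA.
      exact: Lid.
    - move=> Lu0; case/negP: u0; rewrite -memv0 -Lu0.
      by apply/memv_imgP; exists e; rewrite ?lfunE.
  have /memv_imgP[v vL] : e \in (amulr u @: L)%VS by rewrite Lu.
  rewrite lfunE /= => ev; exists (e * v * e); first exact: mem_cornerM.
  by rewrite -mulrA eu -mulrA -ev.
move=> u u0; have uC := subvsP u.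
have [|w wC wu] := linv _ uC; first by apply: contraNneq u0 => u0; apply/eqP/val_inj.
have [|z zC zw] := linv _ wC.
  by apply: contraNneq e0 => w0; rewrite -wu w0 mul0r.
have uz : vsval u = z.
  move: uC zC; rewrite !mem_corner => /andP[_ /eqP eu] /andP[/eqP ze _].
  by rewrite -eu -zw -mulrA wu ze.
apply/unitrP; exists (Subvs wC); split; apply: val_inj => /=.
  by rewrite wu -corner_algid.
by rewrite uz zw -corner_algid.
Qed.

End Corner.

(* Rieffel's argument: [phi (w s) = phi w * s] for [w], [s] in [L] and any
   endomorphism [phi] of the right [eTe]-module [L = T e]; hence [phi] is the left
   multiplication by [\sum_k phi w_k * a_k], where [1 = \sum_k w_k * a_k].         *)
Lemma wedderburn (T : falgType F) :
  simple_algebra T -> exists c, is_capacity T c.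
Proof.
move=> Tsimple; have [L [Lid L0 Lmin]] := minimal_left_ideal T.
have [e [eL e0 Le]] := minimal_left_ideal_idempotent Tsimple Lid L0 Lmin.
have ee := Le e eL.
pose D : falgType F := subvs_of (corner ee e0).
have Ddiv : division_algebra D := corner_division Lid eL Le Lmin.
have [r rE] : exists r : {linear D -> 'End(T)}, forall d v, r d v = v * vsval d.
  apply: bilinear_hom => [d k v w | v k c d].
    by rewrite mulrDl scalerAl.
  by rewrite linearP /= mulrDr scalerAr.
have rM : right_action r by move=> c d v; rewrite !rE mulrA.
have r1 v : r 1 v = v * e by rewrite rE [vsval _]corner_algid.
have [l lE] : exists l : {linear T -> 'End(T)}, forall a v, l a v = a * v.
  apply: bilinear_hom => [a k v w | v k a b].
    by rewrite mulrDr scalerAr.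
  by rewrite mulrDl scalerAl.
(* An empty basis is excluded, as it would give [e = 0]. *)
have [[|m] [v vB]] := right_basis_exists Ddiv rM.
  have [|d] := right_basis_span vB (w := e); first by rewrite r1.
  by rewrite /right_comb big_ord0 => e_0; move: (e0); rewrite e_0 eqxx.
have [|||f fE] := endomorphism_matrix (l := l) rM vB.
- by move=> a b w; rewrite !lE mulrA.
- by move=> w; rewrite lE mul1r.
- by move=> a d w; rewrite !lE !rE mulrA.
exists m.+1, m, D; split=> //; exists f.
have finj : injective f := simple_ahom_inj Tsimple.
suff /choice[g gK] : forall M, exists t, f t = M.
  by exists g => // t; apply: finj; rewrite gK.
(* For surjectivity, [y j] is the image of [v j] prescribed by column [j] of [M], and [phi] the
   resulting endomorphism: it reads coordinates on [v] and puts them on [y]. *)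
move=> M; pose y j := right_comb r v (fun i => (M : 'M_m.+1) i j).
have [gv gvE] := right_comb_hom r v; have [gy gyE] := right_comb_hom r y.
have gvK := lker0_lfunK (introT lker0P (right_free_inj gvE (right_basis_free vB))).
pose phi := (gy \o gv^-1)%VF.
have phiE d : phi (right_comb r v d) = right_comb r y d.
  have fd : right_comb r v d = gv (finfun d).
    by rewrite gvE; apply: eq_bigr => i _; rewrite ffunE.
  by rewrite fd comp_lfunE gvK gyE; apply: eq_bigr => i _; rewrite ffunE.
have vL w : w \in L -> exists d, w = right_comb r v d.
  by move=> wL; apply: (right_basis_span vB); rewrite r1 Le.
have combM (u : 'I_m.+1 -> T) d c :
    right_comb r u d * vsval c = right_comb r u (fun i => d i * c).
  by rewrite -rE linear_sum; apply: eq_bigr => i _; rewrite /= rM.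
have phiM w (c : D) : w \in L -> phi (w * vsval c) = phi w * vsval c.
  by move=> /vL[d ->]; rewrite combM !phiE combM.
have yL j : y j * e = y j.
  rewrite -r1 linear_sum; apply: eq_bigr => i _; exact: right_action1.
have phiL w : w \in L -> phi w * e = phi w.
  move=> /vL[d ->]; rewrite phiE -r1 linear_sum; apply: eq_bigr => i _.
  exact: right_action1.
(* The element [e * s * e] of the corner may replace [s], since [s], [w] and [phi w] absorb [e] on
   the right. *)
have {phiM}phiM w s : w \in L -> s \in L -> phi (w * s) = phi w * s.
  move=> wL sL; have sC := mem_cornerM ee e0 s.
  have := phiM w (Subvs sC) wL; rewrite /= -[e * s * e]mulrA Le // !mulrA Le //.
  by rewrite phiL.
have [t tP] : exists t, forall s, s \in L -> t * s = phi s.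
  have : 1 \in (L * {:T})%VS by rewrite simple_left_idealM ?memvf.
  suff P u : u \in (L * {:T})%VS -> exists t, forall s, s \in L -> t * s = phi (u * s).
    by move=> /P[t tP]; exists t => s /tP->; rewrite mul1r.
  elim/prodv_ind: u / => [|u u' [t tP] [t' tP']|u a uL _].
  - by exists 0 => s _; rewrite !mul0r linear0.
  - by exists (t + t') => s sL; rewrite !mulrDl linearD tP ?tP'.
  - by exists (phi u * a) => s sL; rewrite -!mulrA phiM ?Lid.
exists t; apply: (right_basis_mx_inj vB) => j.
have vjL : v j \in L by rewrite -(right_basis1 vB) r1 Lid.
rewrite -fE lE tP // -(right_comb_delta (right_basis1 vB j)) phiE.
by rewrite right_comb_delta // r1.
Qed.

End Wedderburn.

(** * The capacity of [Delta (x) A^o] and the dimensions of its modules *)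

Section Capacity.
Variable F : fieldType.

(** Once a capacity exists, [xget] returns one and not the default 0. *)
Lemma capacityP (T : falgType F) : simple_algebra T -> is_capacity T (capacity T).
Proof. by move=> /wedderburn; apply: xgetPex. Qed.

(** The module is [k] copies of the space of rows, on which matrices multiply from the right. *)
Lemma matalg_rows (D : falgType F) n k :
  exists (V : vectType F) (r : {linear matalg D n -> 'End(V)}),
    [/\ right_action r, forall v, r 1 v = v
      & \dim {:V} = (k * (n.+1 * \dim {:D}))%N].
Proof.
pose V : vectType F := {ffun 'I_k -> {ffun 'I_n.+1 -> D}}.
pose h (M : matalg D n) (v : V) : V :=
  [ffun i => [ffun j => \sum_l v i l * (M : 'M_n.+1) l j]].
have [M k0 v w|v k0 M N|r rE] := @bilinear_hom F (matalg D n) V V h.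
- apply/ffunP=> i; apply/ffunP=> j; rewrite !ffunE scaler_sumr -big_split.
  by apply: eq_bigr => l _; rewrite !ffunE mulrDl scalerAl.
- apply/ffunP=> i; apply/ffunP=> j; rewrite !ffunE scaler_sumr -big_split.
  by apply: eq_bigr => l _; rewrite mxE matalg_scaleE mulrDr scalerAr.
exists V, r; split=> [M N v|v|]; last by rewrite !dimv_ffun !card_ord.
- rewrite !rE; apply/ffunP=> i; apply/ffunP=> j; rewrite !ffunE.
  under eq_bigr => l _ do rewrite mxE mulr_sumr.
  rewrite exchange_big; apply: eq_bigr => l _; rewrite !ffunE mulr_suml.
  by apply: eq_bigr => o _; rewrite mulrA.
rewrite rE; apply/ffunP=> i; apply/ffunP=> j; rewrite !ffunE (bigD1 j) //=.
rewrite big1 ?addr0 ?mxE ?eqxx ?mulr1 // => l lj.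
by rewrite mxE (negPf lj) mulr0.
Qed.

Section SimpleFactor.
Variables (Delta A : falgType F).
Hypotheses (Ddiv : division_algebra Delta)
  (Dcent : forall x : Delta, (forall y, x * y = y * x) -> exists k : F, x = k%:A)
  (Asimple : simple_algebra A).
Let T := tensor Delta A^c.

Lemma tensor_opp_simple : simple_algebra T.
Proof. exact: (tensor_simple Ddiv Dcent (simple_converse Asimple)). Qed.

Lemma tensor_opp_capacity :
  exists n D (f : 'AHom(T, matalg D n)), [/\ capacity T = n.+1,
    division_algebra D, bijective f
    & (\dim {:Delta} * \dim {:A} = n.+1 * n.+1 * \dim {:D})%N].
Proof.
have [n [D [-> DD [f fbij]]]] := capacityP tensor_opp_simple.
exists n, D, f; split=> //; rewrite -dim_matalg -(dim_bij fbij).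
by rewrite dim_tensor.
Qed.

Lemma tensor_action_dvd (V : vectType F) (r : {linear T -> 'End(V)}) m :
    right_action r -> \dim (limg (r 1)) = (m * \dim {:Delta})%N ->
  (\dim {:A} %| m * capacity T)%N.
Proof.
move=> rM rdim; have [n [D [f [-> DD fbij dimE]]]] := tensor_opp_capacity.
have [g [fK gK]] := ahom_inv fbij; have [r' r'M r'E] := right_action_comp g rM.
have := dvd_dim_matalg_action DD r'M; rewrite r'E rmorph1 rdim.
(* Multiplying by the capacity [n.+1] turns the divisor into [\dim {:Delta} * \dim {:A}]; then
   [\dim {:Delta}] cancels. *)
rewrite -(dvdn_pmul2l (ltn0Sn n)) mulnA -dimE mulnA.
by rewrite mulnC dvdn_pmul2r ?dim_falg_gt0 // mulnC.
Qed.

Lemma dvd_tensor_action m :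
    (\dim {:A} %| m * capacity T)%N ->
  exists (V : vectType F) (r : {linear T -> 'End(V)}),
    [/\ right_action r, forall v, r 1 v = v
      & \dim {:V} = (m * \dim {:Delta})%N].
Proof.
have [n [D [f [-> DD fbij dimE]]]] := tensor_opp_capacity.
(* The quotient [q] is the number of row modules to add up. *)
move=> /dvdnP[q qE]; have [V [r [rM r1 dV]]] := matalg_rows D n q.
have [r' r'M r'E] := right_action_comp f rM.
exists V, r'; split=> // [v|]; first by rewrite r'E rmorph1 r1.
apply/eqP; rewrite dV -(eqn_pmul2r (ltn0Sn n)); apply/eqP.
rewrite [RHS]mulnAC qE -!mulnA; congr (_ * _)%N.
by rewrite [RHS]mulnC dimE [(\dim {:D} * _)%N]mulnC mulnA.
Qed.

(** Restricted to [Delta (x) 1], the module is a right [Delta]-space; restricted to [1 (x) A^o], it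
    carries a left action of [A] commuting with [Delta], hence given by matrices. *)
Lemma dvd_simple_ahom m :
  (\dim {:A} %| m.+1 * capacity T)%N -> inhabited (ahom A (matalg Delta m)).
Proof.
move=> /dvd_tensor_action[V [r [rM r1 dV]]].
have [rD rDE] : exists rD : {linear Delta -> 'End(V)},
    forall d v, rD d v = r (tens d 1) v.
  apply: bilinear_hom => [d k v w | v k c d]; first by rewrite linearP.
  by rewrite tens_linearl linearP add_lfunE scale_lfunE.
have [l lE] : exists l : {linear A -> 'End(V)},
    forall a v, l a v = r (tens 1 (a : A^c)) v.
  apply: bilinear_hom => [d k v w | v k c d]; first by rewrite linearP.
  by rewrite (@tens_linearr F Delta A^c) linearP add_lfunE scale_lfunE.
have rDM : right_action rD.
  by move=> c d v; rewrite !rDE -rM tensM mulr1.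
have [m' [v vB]] := right_basis_exists Ddiv rDM.
have rD1 w : rD 1 w = w by rewrite rDE tens1 r1.
(* Comparing dimensions over [F] shows that the basis has exactly [m.+1] elements. *)
have : (m' * \dim {:Delta})%N = (m.+1 * \dim {:Delta})%N.
  rewrite -(dim_right_basis rDM vB) -dV; congr (\dim _).
  by apply/vspaceP=> w; rewrite memvf limg_right_action // rD1 eqxx.
move/eqP; rewrite eqn_pmul2r ?dim_falg_gt0 // => /eqP mE.
move: v vB; rewrite mE => v vB.
have [|||f _] := endomorphism_matrix (l := l) rDM vB; last exact: (inhabits f).
- by move=> a b w; rewrite !lE -rM tensM mulr1.
- by move=> w; rewrite lE tens1 r1.
- by move=> a d w; rewrite !lE !rDE -!rM !tensM !mulr1 !mul1r.
Qed.

End SimpleFactor.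
End Capacity.

(** * Embeddings of products, and modules over the factors *)

Section Embedding.
Variable F : fieldType.

(** The scalar matrix of a central element of [D] is central, hence a multiple of 1 by an element of
    [F]. *)
Lemma central_matalg (D : falgType F) n :
    'Z({:matalg D n})%VS = 1%VS ->
  forall x : D, (forall y, x * y = y * x) -> exists k : F, x = k%:A.
Proof.
move=> Z1 x xC; pose X : matalg D n := x%:M.
have : X \in 'Z({:matalg D n})%VS.
  rewrite memv_cap memvf; apply/centvP=> M _; apply/matrixP=> i j.
  rewrite !mxE (bigD1 i) //= [in RHS](bigD1 j) //= !big1 ?addr0; first last.
  - by move=> k ki; rewrite mxE eq_sym (negPf ki) mulr0n mul0r.
  - by move=> k kj; rewrite mxE (negPf kj) mulr0n mulr0.
  by rewrite !mxE !eqxx !mulr1n xC.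
rewrite Z1 => /vlineP[k /matrixP/(_ ord0 ord0)].
by rewrite mxE eqxx mulr1n matalg_scaleE mxE eqxx => ->; exists k.
Qed.

Section Coprojections.
Variables (s : nat) (A : 'I_s.+1 -> falgType F).

(** Not unital: [coproj 1] is the central idempotent of the factor [i]. *)
Definition coproj i (a : A i) : prodalg A := prodalg_of (dfwith (fun=> 0) a).

Lemma coproj_linear i : linear (@coproj i).
Proof.
move=> k a b; apply/prodalgP=> j; rewrite !ffunE.
have [<-|ij] := eqVneq i j; first by rewrite !dfwith_in.
by rewrite !dfwith_out // scaler0 addr0.
Qed.

Lemma coprojM i (a b : A i) : coproj (a * b) = coproj a * coproj b.
Proof.
apply/prodalgP=> j; rewrite !ffunE.
have [<-|ij] := eqVneq i j; first by rewrite !dfwith_in.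
by rewrite !dfwith_out // mulr0.
Qed.

Lemma coprojM0 i j (a : A i) (b : A j) : i != j -> coproj a * coproj b = 0.
Proof.
move=> ij; apply/prodalgP=> k; rewrite !ffunE.
have [<-|ik] := eqVneq i k; last by rewrite [X in X * _]dfwith_out ?mul0r.
by rewrite [X in _ * X]dfwith_out ?mulr0 // eq_sym.
Qed.

Lemma prodalg_sumE (I : finType) (x : I -> prodalg A) j :
  (\sum_i x i) j = \sum_i x i j.
Proof.
by apply: (big_morph (fun x : prodalg A => x j)) => [u v|]; rewrite ffunE.
Qed.

Lemma sum_coproj1 : \sum_i coproj (1 : A i) = 1.
Proof.
apply/prodalgP=> j; rewrite prodalg_sumE (bigD1 j) //= big1 => [|i ij].
  by rewrite !ffunE dfwith_in addr0.
by rewrite ffunE dfwith_out.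
Qed.

Lemma coproj1_neq0 i : coproj (1 : A i) != 0.
Proof.
apply/eqP=> /prodalgP/(_ i)/eqP; rewrite !ffunE dfwith_in.
by rewrite oner_eq0.
Qed.

End Coprojections.

(** The space of columns as a bimodule, faithful on the matrix side. *)
Lemma matalg_columns (D : falgType F) n (V := {ffun 'I_n.+1 -> D} : vectType F) :
  exists (l : {linear matalg D n -> 'End(V)}) (r : {linear D -> 'End(V)}),
    [/\ right_action r, forall M N v, l (M * N) v = l M (l N v),
        forall v, r 1 v = v /\ l 1 v = v,
        forall M d v, l M (r d v) = r d (l M v)
      & forall M, l M = 0 -> M = 0].
Proof.
pose f (M : matalg D n) (v : V) : V := [ffun i => \sum_j (M : 'M_n.+1) i j * v j].
pose g (d : D) (v : V) : V := [ffun i => v i * d].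
have [M k v w|v k M N|l lE] := @bilinear_hom F (matalg D n) V V f.
- apply/ffunP=> i; rewrite !ffunE scaler_sumr -big_split.
  by apply: eq_bigr => j _; rewrite !ffunE mulrDr scalerAr.
- apply/ffunP=> i; rewrite !ffunE scaler_sumr -big_split.
  by apply: eq_bigr => j _; rewrite mxE matalg_scaleE mulrDl scalerAl.
have [d k v w|v k c d|r rE] := @bilinear_hom F D V V g.
- by apply/ffunP=> i; rewrite !ffunE mulrDl scalerAl.
- by apply/ffunP=> i; rewrite !ffunE mulrDr scalerAr.
exists l, r; split=> [c d v|M N v|v|M d v|M lM0].
- by rewrite !rE; apply/ffunP=> i; rewrite !ffunE mulrA.
- rewrite !lE; apply/ffunP=> i; rewrite !ffunE.
  under eq_bigr => j _ do rewrite mxE mulr_suml.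
  rewrite exchange_big; apply: eq_bigr => j _; rewrite !ffunE mulr_sumr.
  by apply: eq_bigr => o _; rewrite mulrA.
- rewrite rE lE; split; apply/ffunP=> i; rewrite !ffunE ?mulr1 //.
  rewrite (bigD1 i) //= big1 ?addr0 ?mxE ?eqxx ?mul1r // => j ji.
  by rewrite mxE eq_sym (negPf ji) mul0r.
- rewrite !lE !rE; apply/ffunP=> i; rewrite !ffunE mulr_suml.
  by apply: eq_bigr => j _; rewrite ffunE mulrA.
apply/matrixP=> i j; rewrite [RHS]mxE.
have : l M [ffun k => (k == j)%:R] i = 0 by rewrite lM0 zero_lfunE ffunE.
rewrite lE ffunE (bigD1 j) //= ffunE eqxx mulr1 big1 ?addr0 // => k kj.
by rewrite ffunE (negPf kj) mulr0.
Qed.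

Lemma embeds_prodalg (D : falgType F) n s (A : 'I_s.+1 -> falgType F) :
    division_algebra D ->
    (forall x : D, (forall y, x * y = y * x) -> exists k : F, x = k%:A) ->
    (forall i, simple_algebra (A i)) ->
    embeds (prodalg A) (matalg D n) ->
  exists n_ : 'I_s.+1 -> nat,
    [/\ forall i, (0 < n_ i)%N,
        n.+1 = (\sum_i n_ i)%N
      & forall i, (\dim {:A i} %| n_ i * capacity (tensor D (A i)^c))%N].
Proof.
move=> Ddiv Dcent Asimple [f finj].
have [l [r [rM lM lr1 lr l0]]] := matalg_columns D n.
pose p i := l (f (coproj (1 : A i))).
(* Each [D (x) A_i^o] acts on the whole column space, not unitally: its unit acts as the projection
   [p i], and its module is the image of [p i]. *)
have [g gE] : exists g : forall i, 'Hom(tensor D (A i)^c, 'End({ffun 'I_n.+1 -> D})),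
    forall i d a, g i (tens d a) = (r d \o l (f (coproj (a : A i))))%VF.
  suff /fin_all_exists[g gE] : forall i,
      exists g : 'Hom(tensor D (A i)^c, 'End({ffun 'I_n.+1 -> D})),
      forall d a, g (tens d a) = (r d \o l (f (coproj (a : A i))))%VF by exists g.
  move=> i; apply: tensor_lift => [d k a b | a k c d].
    by rewrite [coproj _](coproj_linear k (a : A i) b) !linearP /= comp_lfunDr comp_lfunZr.
  by rewrite linearP /= comp_lfunDl comp_lfunZl.
pose gl i : {linear tensor D (A i)^c -> 'End({ffun 'I_n.+1 -> D})} := g i.
have gM i : right_action (gl i).
  move=> x y v; elim/tensor_ind: x => [x x' Ex Ex'||d a].
  - by rewrite mulrDl !linearD !add_lfunE linearD Ex Ex'.
  - by rewrite mul0r !linear0 !zero_lfunE linear0.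
  elim/tensor_ind: y => [y y' Ey Ey'||d' a'].
  - by rewrite mulrDr !linearD !add_lfunE Ey Ey'.
  - by rewrite mulr0 !linear0 !zero_lfunE.
  rewrite tensM /gl /= !gE !comp_lfunE /= [coproj _](coprojM (a' : A i) a) rmorphM /= lM rM.
  by rewrite lr.
have g1 i : gl i 1 = p i.
  rewrite /gl /= -tens1 gE; apply/lfunP=> v; rewrite comp_lfunE /=.
  by have [->] := lr1 (l (f (coproj (1 : A i))) v).
have dvdD i : (\dim {:D} %| \dim (limg (p i)))%N.
  have [rD rDE] : exists rD : {linear D -> 'End({ffun 'I_n.+1 -> D})},
      forall d v, rD d v = gl i (tens d 1) v.
    apply: bilinear_hom => [d k v w | v k c d]; first by rewrite linearP.
    by rewrite tens_linearl linearP add_lfunE scale_lfunE.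
  have <-: rD 1 = p i by apply/lfunP=> v; rewrite rDE tens1 g1.
  apply: dvd_dim_right_action => // c d v.
  by rewrite !rDE -gM tensM mulr1.
have rankp i : (\dim (limg (p i)) %/ \dim {:D} * \dim {:D})%N = \dim (limg (p i)).
  by rewrite divnK.
(* [n_ i] is the [D]-dimension of the image of [p i]; the division is exact by [dvdD]. *)
exists (fun i => (\dim (limg (p i)) %/ \dim {:D})%N); split=> [i||i].
- rewrite divn_gt0 ?dim_falg_gt0 // dvdn_leq // lt0n dimv_eq0 -subv0.
  (* If [p i] were zero, faithfulness of [l] and injectivity of [f] would give [coproj 1 = 0]. *)
  apply/negP=> /subvP p0; case/negP: (coproj1_neq0 A i).
  apply/eqP/finj; rewrite linear0; apply: l0; apply/lfunP=> v.
  by rewrite zero_lfunE; apply/eqP; rewrite -memv0 p0 // memv_img ?memvf.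
- apply/eqP; rewrite -(eqn_pmul2r (dim_falg_gt0 D)) big_distrl /=.
  under eq_bigr do rewrite rankp.
  rewrite -dim_limg_orthogonal => [|i v|i j v ij]; first last.
  - by rewrite /p -lM -rmorphM coprojM0 // rmorph0 linear0 zero_lfunE.
  - by rewrite /p -lM -rmorphM -coprojM mulr1.
  rewrite -[X in (X * _)%N](card_ord n.+1) -dimv_ffun; apply/eqP; congr (\dim _).
  apply/vspaceP=> v; rewrite memvf; apply/esym/memv_imgP; exists v; rewrite ?memvf //.
  rewrite /p -linear_sum -linear_sum sum_coproj1 rmorph1.
  by have [_ ->] := lr1 v.
- apply: (tensor_action_dvd Ddiv Dcent (Asimple i) (gM i)).
  by rewrite g1 rankp.
Qed.

(** The product acts by diagonal blocks on columns indexed by the pairs [(i, q)]. Writing this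
    action in any right [D]-basis gives matrices of size [n.+1], without an explicit bijection of
    the pairs with ['I_n.+1]. *)
Lemma prodalg_embeds (D : falgType F) n s (A : 'I_s.+1 -> falgType F)
    (m : 'I_s.+1 -> nat) (g : forall i, 'AHom(A i, matalg D (m i))) :
    division_algebra D -> (forall i, injective (g i)) ->
    n.+1 = (\sum_i (m i).+1)%N ->
  embeds (prodalg A) (matalg D n).
Proof.
move=> Ddiv ginj nE; pose I := {i : 'I_s.+1 & 'I_(m i).+1}.
pose tg i (q : 'I_(m i).+1) : I := Tagged (fun i => 'I_(m i).+1) q.
pose V : vectType F := {ffun I -> D}.
pose G i (a : A i) : 'M[D]_((m i).+1) := g i a.
pose fl (x : prodalg A) (v : V) : V :=
  [ffun u : I => \sum_q G (tag u) (x (tag u)) (tagged u) q * v (tg _ q)].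
pose fr (d : D) (v : V) : V := [ffun u => v u * d].
have GP i k (a b : A i) p q : G i (k *: a + b) p q = k *: G i a p q + G i b p q.
  by rewrite /G linearP mxE matalg_scaleE.
have [x k v w|v k x y|l lE] := @bilinear_hom F (prodalg A) V V fl.
- apply/ffunP=> u; rewrite !ffunE scaler_sumr -big_split.
  by apply: eq_bigr => j _; rewrite !ffunE mulrDr scalerAr.
- apply/ffunP=> u; rewrite !ffunE scaler_sumr -big_split.
  by apply: eq_bigr => j _; rewrite GP mulrDl scalerAl.
have [d k v w|v k c d|r rE] := @bilinear_hom F D V V fr.
- by apply/ffunP=> u; rewrite !ffunE mulrDl scalerAl.
- by apply/ffunP=> u; rewrite !ffunE mulrDr scalerAr.
have rM : right_action r.
  by move=> c d v; rewrite !rE; apply/ffunP=> u; rewrite !ffunE mulrA.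
have r1 v : r 1 v = v by rewrite rE; apply/ffunP=> u; rewrite ffunE mulr1.
have lr x d v : l x (r d v) = r d (l x v).
  rewrite !lE !rE; apply/ffunP=> u; rewrite !ffunE mulr_suml.
  by apply: eq_bigr => j _; rewrite ffunE mulrA.
have [k [v vB]] := right_basis_exists Ddiv rM.
have : (k * \dim {:D})%N = (n.+1 * \dim {:D})%N.
  rewrite -(dim_right_basis rM vB) nE.
  have <- : #|{: I}| = (\sum_i (m i).+1)%N.
    by rewrite card_tagged sumnE big_map big_enum; apply: eq_bigr => i _; rewrite card_ord.
  rewrite -dimv_ffun; congr (\dim _).
  by apply/vspaceP=> w; rewrite memvf limg_right_action // r1 eqxx.
move/eqP; rewrite eqn_pmul2r ?dim_falg_gt0 // => /eqP kE.
move: v vB; rewrite {}kE => v vB.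
have [x y w|w||f fE] := endomorphism_matrix (l := l) rM vB; last first.
- exists f => x y fxy.
  have lxy w : l x w = l y w.
    have [d ->] := right_basis_span vB (r1 w).
    rewrite /right_comb !linear_sum; apply: eq_bigr => j _ /=.
    by rewrite !lr !fE fxy.
  apply/prodalgP=> i; apply: ginj; apply/matrixP=> p q.
  (* Unit columns recover the entries of block [i], so the action determines each [g i (z i)]. *)
  have GE z : l z [ffun u => (u == tg _ q)%:R] (tg _ p) = G i (z i) p q.
    rewrite lE ffunE (bigD1 q) //= ffunE eqxx mulr1 big1 ?addr0 // => o oq.
    by rewrite ffunE eq_Tagged (negPf oq) mulr0.
  by have := congr1 (fun v : V => v (tg _ p)) (lxy [ffun u => (u == tg _ q)%:R]);
     rewrite !GE.
- exact: lr.
- rewrite lE; apply/ffunP=> u; rewrite ffunE (bigD1 (tagged u)) //= big1.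
    by case: u => i p /=; rewrite /G ffunE rmorph1 mxE eqxx mul1r addr0.
  by move=> q qu; rewrite /G ffunE rmorph1 mxE eq_sym (negPf qu) mul0r.
rewrite !lE; apply/ffunP=> u; rewrite !ffunE.
under eq_bigr => j _ do rewrite /G rmorphM mxE mulr_suml.
rewrite exchange_big; apply: eq_bigr => j _; rewrite !ffunE mulr_sumr.
by apply: eq_bigr => o _; rewrite mulrA.
Qed.

End Embedding.

Theorem theorem1p3 (F : fieldType) (n : nat) (Delta : falgType F)
    (hDelta : division_algebra Delta)
    (hB : central_simple_algebra (matalg Delta n))
    (s : nat) (A : 'I_s.+1 -> falgType F)
    (hA : forall i, simple_algebra (A i)) :
  embeds (prodalg A) (matalg Delta n) <->
  exists n_ : 'I_s.+1 -> nat,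
    [/\ forall i, (0 < n_ i)%N,
        n.+1 = (\sum_i n_ i)%N
      & forall i, (\dim {:A i} %| n_ i * capacity (tensor Delta (A i)^c))%N].
Proof.
have Dcent := central_matalg hB.1; split; first exact: embeds_prodalg.
move=> [n_ [n_gt0 nE ndvd]].
(* [matalg Delta k] has size [k.+1], hence the predecessor. The dummy [True] makes an existential of
   [inhabited], so that homomorphisms can be chosen for all [i] at once. *)
have /fin_all_exists[g _] i :
    exists _ : 'AHom(A i, matalg Delta (n_ i).-1), True.
  have [|g] := dvd_simple_ahom hDelta Dcent (hA i) (m := (n_ i).-1).
    by rewrite prednK.
  by exists g.
apply: (prodalg_embeds hDelta (g := g)) => [i|]; first exact: simple_ahom_inj.
by rewrite nE; apply: eq_bigr => i _; rewrite prednK.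
Qed.
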